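(* Let $\mathfrak{u}$ be the nilpotent radical of a standard parabolic subalgebra $\mathfrak{p}(d)$ of $\mathfrak{sl}_{n+1}(K)$. There exists an admissible ideal $J$ of the path algebra $KQ(d)$, generated by all commutativity relations $\omega_1-\omega_2$, such that $\mathfrak{u}\cong \mathrm{rad}\,KQ(d)/J$ as Lie algebras.
   Context: $K$ is an algebraically closed field of characteristic $p>0$. A dimension vector is a tuple $d=(d_1,\ldots,d_\ell)$ of positive integers with $\sum_i d_i=n+1$. $\mathfrak{p}(d)\subseteq\mathfrak{sl}_{n+1}(K)$ is the standard (block upper-triangular) parabolic subalgebra with diagonal block sizes $d_1,\ldots,d_\ell$, and $\mathfrak{u}$ is its nilradical (strictly block upper-triangular matrices), which is spanned by those matrix units $e_{i,j}$, $i<j$, with $i,j$ in different blocks. Horizontal line diagram $L_h(d)$: arrange $\ell$ columns of $d_1,\ldots,d_\ell$ dots, top-adjusted; label the dots $1,\ldots,n+1$ column by column from left to right, top to bottom in each column; join each dot by a horizontal line to the next dot to its right in the same row, if there is one (possibly skipping columns having no dot in that row). The quiver $Q(d)$ has vertex set $\Gamma_0=\{1,\ldots,n+1\}$; there is exactly one arrow $a\to b$ whenever either $a - b$ is a horizontal line of $L_h(d)$ with $a$ to the left of $b$, or $a,b$ lie in two adjacent columns with the column of $a$ on the left; there are no other arrows. $KQ(d)$ is the path algebra, where the product $\omega\omega'$ of two paths means $\omega$ followed by $\omega'$; $\mathrm{rad}\,KQ(d)$ is its radical (spanned by the paths of positive length), regarded as a Lie algebra via $[x,y]=xy-yx$,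 and its quotient by $J$ carries the induced Lie bracket. A commutativity relation is an element $\omega_1-\omega_2$ with $\omega_1,\omega_2$ paths of positive length having the same source and the same target.
   Formalization: ''Admissible'' (J inside the square of the radical) is claimed only when no horizontal line skips a column; otherwise, as for d=(2,1,2), it fails, and only rad^m ⊆ J ⊆ rad is claimed. Generation by the relations and the Lie isomorphism are stated for all d. *)

(* Defs.v *)
From HB Require Import structures.
From mathcomp Require Import all_boot all_order all_algebra.
From mathcomp Require Import generic_quotient ring_quotient.
From mathcomp Require Import finmap.
From mathcomp.multinomials Require Import monalg.

Set Implicit Arguments.
Unset Strict Implicit.
Unset Printing Implicit Defensive.

Import GRing.Theory.

Local Open Scope ring_scope.
Local Open Scope quotient_scope.

HB.mixin Record Lmodule_isLieAlgebra (R : comNzRingType) L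
    of GRing.Lmodule R L := {
  lie : L -> L -> L;
  lieDl : forall x y z, lie (x + y) z = lie x z + lie y z;
  lieDr : forall x y z, lie x (y + z) = lie x y + lie x z;
  lieZl : forall (a : R) x y, lie (a *: x) y = a *: lie x y;
  lieZr : forall (a : R) x y, lie x (a *: y) = a *: lie x y;
  liexx : forall x, lie x x = 0;
  lie_jacobi : forall x y z,
    lie x (lie y z) + lie y (lie z x) + lie z (lie x y) = 0
}.

#[short(type="lieAlgType")]
HB.structure Definition LieAlgebra (R : comNzRingType) :=
  {L of GRing.Lmodule R L & Lmodule_isLieAlgebra R L}.

Definition lie_isomorphic (R : comNzRingType) (L M : lieAlgType R) : Prop :=
  exists2 f : {linear L -> M}, bijective f & {morph f : x y / lie x y}.

HB.mixin Record isLieIdeal (R : comNzRingType) (L : lieAlgType R)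
    (I : L -> bool) := {
  lie_idealZ : forall (a : R) x,
    x \in (I : {pred L}) -> a *: x \in (I : {pred L});
  lie_ideal_lie : forall x y,
    y \in (I : {pred L}) -> lie x y \in (I : {pred L})
}.

#[short(type="lieIdeal")]
HB.structure Definition LieIdeal (R : comNzRingType) (L : lieAlgType R) :=
  {I of GRing.ZmodClosed L I & isLieIdeal R L I}.

Section LieQuotient.
Variables (R : comNzRingType) (L : lieAlgType R) (I : lieIdeal L).

Lemma lieNl (x y : L) : lie (- x) y = - lie x y.
Proof. by rewrite -scaleN1r lieZl scaleN1r. Qed.

Lemma lieNr (x y : L) : lie x (- y) = - lie x y.
Proof. by rewrite -scaleN1r lieZr scaleN1r. Qed.

Lemma lieC (x y : L) : lie x y = - lie y x.
Proof.
apply/eqP; rewrite -addr_eq0; apply/eqP.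
by have := liexx (x + y); rewrite lieDl !lieDr !liexx add0r addr0.
Qed.

Lemma lieIl (x y : L) : x \in I -> lie x y \in I.
Proof. by move=> xI; rewrite lieC rpredN lie_ideal_lie. Qed.

Lemma lieIr (x y : L) : y \in I -> lie x y \in I.
Proof. exact: lie_ideal_lie. Qed.

Definition lie_quot : Type := Quotient.quot I.

HB.instance Definition _ := GRing.Zmodule.on lie_quot.
HB.instance Definition _ := EqQuotient.on lie_quot.

Definition lq_scale (a : R) := lift_op1 lie_quot ( *:%R a).
Definition lq_lie := lift_op2 lie_quot (@lie R L).

Lemma pi_lq_scale a : {morph \pi_lie_quot : x / a *: x >-> lq_scale a x}.
Proof.
move=> x; rewrite /lq_scale; unlock; apply/eqP.
by rewrite -Quotient.idealrBE -scalerBr lie_idealZ // Quotient.idealrBE reprK.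
Qed.

Lemma pi_lq_lie : {morph \pi_lie_quot : x y / lie x y >-> lq_lie x y}.
Proof.
move=> x y; rewrite /lq_lie; unlock; apply/eqP.
set x' := repr _; set y' := repr _.
have xx' : x - x' \in I by rewrite Quotient.idealrBE reprK.
have yy' : y - y' \in I by rewrite Quotient.idealrBE reprK.
rewrite -Quotient.idealrBE -(subrKA (lie x' y)) -lieNl -lieDl -lieNr -lieDr.
by apply: rpredD; [apply: lieIl | apply: lieIr].
Qed.

Lemma pi_lqD : {morph \pi_lie_quot : x y / x + y}.
Proof. by move=> x y; rewrite Quotient.pi_add. Qed.

Lemma lq_ind (P : lie_quot -> Prop) : (forall x, P (\pi x)) -> forall x, P x.
Proof. by move=> Ppi x; rewrite -[x]reprK. Qed.

Lemma lq_scaleA a b v : lq_scale a (lq_scale b v) = lq_scale (a * b) v.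
Proof. by elim/lq_ind: v => v; rewrite -!pi_lq_scale scalerA. Qed.

Lemma lq_scale1 : left_id 1 lq_scale.
Proof. by elim/lq_ind=> v; rewrite -pi_lq_scale scale1r. Qed.

Lemma lq_scaleDr : right_distributive lq_scale +%R.
Proof.
move=> a; elim/lq_ind=> u; elim/lq_ind=> v.
by rewrite -pi_lqD -!pi_lq_scale -pi_lqD scalerDr.
Qed.

Lemma lq_scaleDl v : {morph lq_scale^~ v : a b / a + b}.
Proof.
by move=> a b; elim/lq_ind: v => v; rewrite -!pi_lq_scale -pi_lqD scalerDl.
Qed.

HB.instance Definition _ := GRing.Zmodule_isLmodule.Build R lie_quot
  lq_scaleA lq_scale1 lq_scaleDr lq_scaleDl.

Lemma pi_lqZ a x :
  \pi_lie_quot (a *: x) = a *: (\pi_lie_quot x : lie_quot) :> lie_quot.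
Proof. exact: pi_lq_scale. Qed.

Lemma pi_lq0 : \pi_lie_quot 0 = 0 :> lie_quot.
Proof. by rewrite -[in LHS](scale0r 0) pi_lqZ scale0r. Qed.

Lemma lq_lieDl x y z : lq_lie (x + y) z = lq_lie x z + lq_lie y z.
Proof.
elim/lq_ind: x => x; elim/lq_ind: y => y; elim/lq_ind: z => z.
by rewrite -pi_lqD -!pi_lq_lie -pi_lqD lieDl.
Qed.

Lemma lq_lieDr x y z : lq_lie x (y + z) = lq_lie x y + lq_lie x z.
Proof.
elim/lq_ind: x => x; elim/lq_ind: y => y; elim/lq_ind: z => z.
by rewrite -pi_lqD -!pi_lq_lie -pi_lqD lieDr.
Qed.

Lemma lq_lieZl a x y : lq_lie (a *: x) y = a *: lq_lie x y.
Proof.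
elim/lq_ind: x => x; elim/lq_ind: y => y.
by rewrite -pi_lqZ -!pi_lq_lie lieZl pi_lqZ.
Qed.

Lemma lq_lieZr a x y : lq_lie x (a *: y) = a *: lq_lie x y.
Proof.
elim/lq_ind: x => x; elim/lq_ind: y => y.
by rewrite -pi_lqZ -!pi_lq_lie lieZr pi_lqZ.
Qed.

Lemma lq_liexx x : lq_lie x x = 0.
Proof.
by elim/lq_ind: x => x; rewrite -pi_lq_lie liexx pi_lq0.
Qed.

Lemma lq_jacobi x y z :
  lq_lie x (lq_lie y z) + lq_lie y (lq_lie z x) + lq_lie z (lq_lie x y) = 0.
Proof.
elim/lq_ind: x => x; elim/lq_ind: y => y; elim/lq_ind: z => z.
by rewrite -!pi_lq_lie -!pi_lqD lie_jacobi pi_lq0.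
Qed.

HB.instance Definition _ := Lmodule_isLieAlgebra.Build R lie_quot
  lq_lieDl lq_lieDr lq_lieZl lq_lieZr lq_liexx lq_jacobi.

End LieQuotient.

HB.mixin Record isNuSubalg (R : comNzRingType) (A : algType R)
    (S : A -> bool) := {
  nu_subalgZ : forall (a : R) x,
    x \in (S : {pred A}) -> a *: x \in (S : {pred A});
  nu_subalgM : forall x y, x \in (S : {pred A}) -> y \in (S : {pred A}) ->
    x * y \in (S : {pred A})
}.

(* A subalgebra that need not contain 1. *)
#[short(type="nuSubalg")]
HB.structure Definition NuSubalg (R : comNzRingType) (A : algType R) :=
  {S of GRing.ZmodClosed A S & isNuSubalg R A S}.

HB.mixin Record isTwoSided (R : comNzRingType) (A : algType R)
    (J : A -> bool) := {
  two_sided_l : forall a x, x \in (J : {pred A}) -> a * x \in (J : {pred A});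
  two_sided_r : forall a x, x \in (J : {pred A}) -> x * a \in (J : {pred A})
}.

#[short(type="twoSidedIdeal")]
HB.structure Definition TwoSidedIdeal (R : comNzRingType) (A : algType R) :=
  {J of GRing.ZmodClosed A J & isTwoSided R A J}.

Definition generates (R : comNzRingType) (A : algType R)
    (S : A -> Prop) (J : twoSidedIdeal A) : Prop :=
  (forall x, S x -> x \in J) /\
  (forall I : twoSidedIdeal A,
     (forall x, S x -> x \in I) -> {subset J <= I}).

Section CommutatorLie.
Variables (R : comNzRingType) (A : algType R) (S : nuSubalg A).

(* [S] as a Lie algebra for the bracket x y - y x. *)
Record lie_of : predArgType := LieOf { lie_val : A; _ : lie_val \in S }.

HB.instance Definition _ := [isSub for lie_val].
HB.instance Definition _ := [Choice of lie_of by <:].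

Lemma nu_subalg_subsemimod : subsemimod_closed S.
Proof.
split; last exact: nu_subalgZ.
by split=> [|x y]; [exact: rpred0 | exact: rpredD].
Qed.

HB.instance Definition _ := GRing.SubChoice_isSubLmodule.Build R A _ lie_of
  nu_subalg_subsemimod.

Lemma lie_of_subproof (x y : lie_of) :
  lie_val x * lie_val y - lie_val y * lie_val x \in S.
Proof. by case: x y => [x xS] [y yS]; rewrite rpredB ?nu_subalgM. Qed.

Definition lie_of_lie (x y : lie_of) : lie_of := LieOf (lie_of_subproof x y).

Lemma lie_of_lieDl x y z :
  lie_of_lie (x + y) z = lie_of_lie x z + lie_of_lie y z.
Proof. by apply: val_inj; rewrite /= mulrDl mulrDr opprD addrACA. Qed.

Lemma lie_of_lieDr x y z :
  lie_of_lie x (y + z) = lie_of_lie x y + lie_of_lie x z.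
Proof. by apply: val_inj; rewrite /= mulrDl mulrDr opprD addrACA. Qed.

Lemma lie_of_lieZl a x y : lie_of_lie (a *: x) y = a *: lie_of_lie x y.
Proof. by apply: val_inj; rewrite /= scalerBr scalerAl scalerAr. Qed.

Lemma lie_of_lieZr a x y : lie_of_lie x (a *: y) = a *: lie_of_lie x y.
Proof. by apply: val_inj; rewrite /= scalerBr scalerAr scalerAl. Qed.

Lemma lie_of_liexx x : lie_of_lie x x = 0.
Proof. by apply: val_inj; rewrite /= subrr. Qed.

Lemma lie_of_jacobi x y z :
  lie_of_lie x (lie_of_lie y z) + lie_of_lie y (lie_of_lie z x)
    + lie_of_lie z (lie_of_lie x y) = 0.
Proof.
apply: val_inj => /=.
case: x y z => [x _] [y _] [z _] /=.
rewrite !mulrBr !mulrBl !mulrA !opprB.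
move: (x * y * z) (x * z * y) (y * z * x) (z * y * x) (y * x * z) (z * x * y).
move=> a b c d e f.
rewrite (AC ((2*2)*(2*2)*(2*2)) ((1*12)*(7*2)*(3*10)*(5*4)*(11*6)*(9*8)))%AC /=.
by rewrite !subrr !addr0.
Qed.

HB.instance Definition _ := Lmodule_isLieAlgebra.Build R lie_of
  lie_of_lieDl lie_of_lieDr lie_of_lieZl lie_of_lieZr lie_of_liexx
  lie_of_jacobi.

Variable J : twoSidedIdeal A.

Definition lie_restr : lie_of -> bool := fun x => lie_val x \in J.

Lemma lie_restrE x : (x \in lie_restr) = (val x \in J).
Proof. by []. Qed.

Lemma lie_restr_zmod : zmod_closed lie_restr.
Proof.
split=> [|x y]; rewrite !lie_restrE ?raddf0 ?rpred0 // => xJ yJ.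
by rewrite raddfB rpredB.
Qed.

HB.instance Definition _ := GRing.isZmodClosed.Build lie_of lie_restr
  lie_restr_zmod.

Lemma lie_restrZ (a : R) x : x \in lie_restr -> a *: x \in lie_restr.
Proof. by rewrite !lie_restrE linearZ /= -mulr_algl; apply: two_sided_l. Qed.

Lemma lie_restr_lie x y : y \in lie_restr -> lie x y \in lie_restr.
Proof.
rewrite !lie_restrE => yJ.
by apply: rpredB; [apply: two_sided_l | apply: two_sided_r].
Qed.

HB.instance Definition _ := isLieIdeal.Build R lie_of lie_restr
  lie_restrZ lie_restr_lie.

End CommutatorLie.

(* Nonempty, so that 1 != 0 in the path algebra. *)
Record quiver := Quiver {
  vertex : finType;
  arrow : finType;
  src : arrow -> vertex;
  tgt : arrow -> vertex;
  vertex_gt0 : (0 < #|vertex|)%N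
}.

Section Paths.
Variable Q : quiver.

Definition composable (w : vertex Q * seq (arrow Q)) : bool :=
  [seq src a | a <- w.2] == belast w.1 [seq tgt a | a <- w.2].

(* A path is given by its source and its arrows, in order; without arrows, it
   is the trivial path at its source. *)
Record qpath : predArgType :=
  QPath { qval : vertex Q * seq (arrow Q); _ : composable qval }.

HB.instance Definition _ := [isSub for qval].
HB.instance Definition _ := [Choice of qpath by <:].

Definition psrc (w : qpath) : vertex Q := (qval w).1.
Definition parr (w : qpath) : seq (arrow Q) := (qval w).2.
Definition ptgt (w : qpath) : vertex Q := last (psrc w) [seq tgt a | a <- parr w].
Definition plen (w : qpath) : nat := size (parr w).

Definition triv (v : vertex Q) : qpath := @QPath (v, [::]) (eqxx _).

Definition pcat (w w' : qpath) : option qpath :=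
  if ptgt w == psrc w' then insub (psrc w, parr w ++ parr w') else None.

Lemma pcatP w w' : ptgt w = psrc w' ->
  exists2 u, pcat w w' = Some u & qval u = (psrc w, parr w ++ parr w').
Proof.
rewrite /pcat => e; rewrite e eqxx; case: insubP => [u _ uE|]; first by exists u.
case/negP; case: w w' e => [[v s] /= vs] [[v' s'] /= vs'].
rewrite /ptgt /psrc /parr /composable /= => e.
by rewrite !map_cat belast_cat e -(eqP vs') -(eqP vs).
Qed.

Lemma pcat_neq w w' : ptgt w != psrc w' -> pcat w w' = None.
Proof. by rewrite /pcat => /negPf ->. Qed.

Lemma pcat_triv_l w : pcat (triv (psrc w)) w = Some w.
Proof.
have [|u -> uE] := @pcatP (triv (psrc w)) w; first by [].
by congr Some; apply: val_inj; rewrite /= uE /psrc /parr /=; case: (qval w).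
Qed.

Lemma pcat_triv_r w : pcat w (triv (ptgt w)) = Some w.
Proof.
have [|u -> uE] := @pcatP w (triv (ptgt w)); first by [].
by congr Some; apply: val_inj; rewrite /= uE cats0 /psrc /parr; case: (qval w).
Qed.

Lemma pcat_src w w' u : pcat w w' = Some u -> psrc u = psrc w.
Proof.
have [/pcatP[v -> vE] [<-]|/pcat_neq -> //] := eqVneq (ptgt w) (psrc w').
by rewrite /psrc vE.
Qed.

Lemma pcat_tgt w w' u : pcat w w' = Some u -> ptgt u = ptgt w'.
Proof.
have [e|/pcat_neq -> //] := eqVneq (ptgt w) (psrc w').
have [v -> vE] := pcatP e => -[<-].
by rewrite /ptgt /psrc /parr vE /= map_cat last_cat -/(parr w) -/(ptgt w) e.
Qed.

Lemma pcat_len w w' u : pcat w w' = Some u -> plen u = (plen w + plen w')%N.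
Proof.
have [/pcatP[v -> vE] [<-]|/pcat_neq -> //] := eqVneq (ptgt w) (psrc w').
by rewrite /plen /parr vE /= size_cat.
Qed.

Lemma pcatA x y z :
  obind (pcat x) (pcat y z) = obind (pcat^~ z) (pcat x y).
Proof.
have [xy|xy] := eqVneq (ptgt x) (psrc y); last first.
  rewrite (pcat_neq xy) /=; case yz: (pcat y z) => [u|] //=.
  by rewrite pcat_neq // (pcat_src yz).
have [yz|yz] := eqVneq (ptgt y) (psrc z); last first.
  rewrite (pcat_neq yz) /=; case e: (pcat x y) => [u|] //=.
  by rewrite pcat_neq // (pcat_tgt e).
have [u eu uE] := pcatP xy; have [v ev vE] := pcatP yz.
rewrite eu ev /=.
have [|w -> wE] := @pcatP x v; first by rewrite (pcat_src ev).
have [|w' -> w'E] := @pcatP u z; first by rewrite (pcat_tgt eu).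
congr Some; apply: val_inj.
by rewrite /= wE w'E /psrc /parr uE vE /= catA.
Qed.

End Paths.

(* Finitely supported functions from paths to K. The operations are locked:
   unification would otherwise unfold them down to finite maps. *)
Definition path_alg (K : comNzRingType) (Q : quiver) : Type := {malg K[qpath Q]}.

HB.instance Definition _ (K : comNzRingType) (Q : quiver) :=
  Choice.on (path_alg K Q).

HB.lock Definition pzero (K : comNzRingType) (Q : quiver) : path_alg K Q :=
  0 : {malg K[qpath Q]}.
HB.lock Definition popp (K : comNzRingType) (Q : quiver) (f : path_alg K Q) :
  path_alg K Q := - (f : {malg K[qpath Q]}).
HB.lock Definition padd (K : comNzRingType) (Q : quiver) (f g : path_alg K Q) :
  path_alg K Q := (f : {malg K[qpath Q]}) + g.
HB.lock Definition pscale (K : comNzRingType) (Q : quiver) (a : K)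
  (f : path_alg K Q) : path_alg K Q := a *: (f : {malg K[qpath Q]}).
HB.lock Definition pbasis (K : comNzRingType) (Q : quiver) (w : qpath Q) :
  path_alg K Q := << w >>.

Definition pcoef (K : comNzRingType) (Q : quiver) (w : qpath Q)
  (f : path_alg K Q) : K := f@_w.

Definition psupp (K : comNzRingType) (Q : quiver) (f : path_alg K Q) :
  {fset qpath Q} := msupp f.

Section PathModule.
Variables (K : comNzRingType) (Q : quiver).
Local Notation path_alg := (path_alg K Q).

Lemma pcoefP (f g : path_alg) : (forall w, pcoef w f = pcoef w g) -> f = g.
Proof. by move/malgP. Qed.

Let pcoefE := (pzero.unlock, popp.unlock, padd.unlock, pscale.unlock, @mcoeff0,
  @mcoeffN, @mcoeffD, @mcoeffZ).

Lemma paddA : associative (@padd K Q).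
Proof. by move=> f g h; apply: pcoefP => w; rewrite /pcoef !pcoefE addrA. Qed.
Lemma paddC : commutative (@padd K Q).
Proof. by move=> f g; apply: pcoefP => w; rewrite /pcoef !pcoefE addrC. Qed.
Lemma padd0 : left_id (@pzero K Q) (@padd K Q).
Proof. by move=> f; apply: pcoefP => w; rewrite /pcoef !pcoefE add0r. Qed.
Lemma paddN : left_inverse (@pzero K Q) (@popp K Q) (@padd K Q).
Proof. by move=> f; apply: pcoefP => w; rewrite /pcoef !pcoefE addNr. Qed.

HB.instance Definition _ :=
  GRing.isZmodule.Build path_alg paddA paddC padd0 paddN.

Lemma pcoef0 w : pcoef w (0 : path_alg) = 0.
Proof. by rewrite /pcoef /GRing.zero /= !pcoefE. Qed.
Lemma pcoefN w (f : path_alg) : pcoef w (- f) = - pcoef w f.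
Proof. by rewrite /pcoef /GRing.opp /= !pcoefE. Qed.
Lemma pcoefD w (f g : path_alg) : pcoef w (f + g) = pcoef w f + pcoef w g.
Proof. by rewrite /pcoef /GRing.add /= !pcoefE. Qed.

Lemma pcoef_scale w a (f : path_alg) : pcoef w (pscale a f) = a * pcoef w f.
Proof. by rewrite /pcoef pscale.unlock mcoeffZ. Qed.

Lemma pscaleA a b (f : path_alg) : pscale a (pscale b f) = pscale (a * b) f.
Proof. by apply: pcoefP => w; rewrite !pcoef_scale mulrA. Qed.
Lemma pscale1 : left_id 1 (@pscale K Q).
Proof. by move=> f; apply: pcoefP => w; rewrite pcoef_scale mul1r. Qed.
Lemma pscaleDr : right_distributive (@pscale K Q) +%R.
Proof.
move=> a f g; apply: pcoefP => w.
by rewrite [RHS]pcoefD !pcoef_scale -mulrDr -pcoefD.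
Qed.
Lemma pscaleDl (f : path_alg) : {morph (@pscale K Q)^~ f : a b / a + b}.
Proof.
by move=> a b; apply: pcoefP => w; rewrite [RHS]pcoefD !pcoef_scale mulrDl.
Qed.

HB.instance Definition _ := GRing.Zmodule_isLmodule.Build K path_alg
  pscaleA pscale1 pscaleDr pscaleDl.

Lemma pcoefZ w a (f : path_alg) : pcoef w (a *: f) = a * pcoef w f.
Proof. by rewrite /pcoef /GRing.scale /= !pcoefE. Qed.

Lemma pcoef_is_linear w : linear_for *%R (pcoef w : path_alg -> K).
Proof. by move=> a f g; rewrite pcoefD pcoefZ. Qed.

HB.instance Definition _ w :=
  GRing.isLinear.Build K path_alg K _ (pcoef w) (pcoef_is_linear w).

Lemma pcoef_basis (w u : qpath Q) : pcoef u (pbasis K w) = (w == u)%:R.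
Proof. by rewrite pbasis.unlock /pcoef mcoeffU. Qed.

Lemma pcoef_eq0 w (f : path_alg) : (pcoef w f == 0) = (w \notin psupp f).
Proof. exact: mcoeff_eq0. Qed.

End PathModule.

(* K-linear extension of a map defined on the basis of paths *)
Definition plin (K : comNzRingType) (Q : quiver) (V : lmodType K)
    (F : qpath Q -> V) (f : path_alg K Q) : V :=
  \sum_(w <- psupp f) pcoef w f *: F w.

Definition pbmul (K : comNzRingType) (Q : quiver) (w w' : qpath Q) :
    path_alg K Q :=
  oapp (@pbasis K Q) 0 (pcat w w').

HB.lock Definition pmul (K : comNzRingType) (Q : quiver) (f g : path_alg K Q) :
    path_alg K Q :=
  plin (fun w => plin (pbmul K w) g) f.

Section PathAlgebra.
Variables (K : comNzRingType) (Q : quiver).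
Local Notation path_alg := (path_alg K Q).
Local Notation pbasis := (@pbasis K Q).
Local Notation pbmul := (@pbmul K Q).
Local Notation pmul := (@pmul K Q).

Definition pone : path_alg := \sum_v pbasis (triv v).

Lemma plinEw (V : lmodType K) (F : qpath Q -> V) f (D : {fset qpath Q}) :
  {subset psupp f <= D} -> plin F f = \sum_(w <- D) pcoef w f *: F w.
Proof.
move=> sfD; apply: big_fset_incl; first exact/fsubsetP.
by move=> w _; rewrite -pcoef_eq0 => /eqP ->; rewrite scale0r.
Qed.

Lemma plin_is_linear (V : lmodType K) (F : qpath Q -> V) : linear (plin F).
Proof.
move=> a f g; pose D := (psupp f `|` psupp g)%fset.
rewrite (@plinEw _ _ f D) ?(@plinEw _ _ g D) ?(@plinEw _ _ (a *: f + g) D).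
- rewrite scaler_sumr -big_split /=; apply: eq_bigr => w _.
  by rewrite pcoefD pcoefZ scalerDl scalerA.
- move=> w; apply: contraLR; rewrite in_fsetU negb_or -!pcoef_eq0.
  by rewrite pcoefD pcoefZ => /andP[/eqP -> /eqP ->]; rewrite mulr0 addr0.
- by move=> w; rewrite in_fsetU => ->; rewrite orbT.
- by move=> w; rewrite in_fsetU => ->.
Qed.

HB.instance Definition _ (V : lmodType K) (F : qpath Q -> V) :=
  GRing.isLinear.Build K path_alg V _ (@plin K Q V F) (@plin_is_linear V F).

Lemma plinZ (V : lmodType K) (F : qpath Q -> V) a f :
  plin F (a *: f) = a *: plin F f.
Proof. exact: linearZ. Qed.

Lemma plin_basis (V : lmodType K) (F : qpath Q -> V) w :
  plin F (pbasis w) = F w.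
Proof.
rewrite (@plinEw _ _ _ [fset w]%fset) ?big_seq_fset1 ?pcoef_basis ?eqxx ?scale1r //.
move=> u; apply: contraLR; rewrite in_fset1 -pcoef_eq0 pcoef_basis eq_sym.
by move/negPf ->.
Qed.

Lemma path_algE (f : path_alg) :
  f = \sum_(w <- psupp f) pcoef w f *: pbasis w.
Proof.
apply: pcoefP => u; rewrite raddf_sum /=.
have [uf|uf] := boolP (u \in psupp f).
  rewrite (big_fsetD1 u) //= pcoefZ pcoef_basis eqxx mulr1 big1_fset ?addr0 //.
  move=> w; rewrite in_fsetD1 => /andP[/negPf wu _] _.
  by rewrite pcoefZ pcoef_basis wu mulr0.
rewrite big1_fset; first by apply/eqP; rewrite pcoef_eq0.
move=> w wf _; rewrite pcoefZ pcoef_basis; case: eqP => [wu|_]; last exact: mulr0.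
by rewrite wu (negPf uf) in wf.
Qed.

Lemma path_alg_ind (P : path_alg -> Prop) :
    P 0 -> (forall a w f, P f -> P (a *: pbasis w + f)) -> forall f, P f.
Proof.
move=> P0 PD f; rewrite [f]path_algE; elim: (enum_fset (psupp f)) => [|w r IHr].
  by rewrite big_nil.
by rewrite big_cons; apply: PD.
Qed.

Lemma pmulDl : left_distributive pmul +%R.
Proof. by move=> f g h; rewrite !pmul.unlock raddfD. Qed.

Lemma pmulZl a f g : a *: pmul f g = pmul (a *: f) g.
Proof. by rewrite !pmul.unlock linearZ. Qed.

Lemma pmulDr : right_distributive pmul +%R.
Proof.
move=> f g h; rewrite !pmul.unlock /plin -big_split /=; apply: eq_bigr => w _.
rewrite -scalerDr; congr (_ *: _); exact: (raddfD (plin (pbmul w))).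
Qed.

Lemma pmulZr a f g : a *: pmul f g = pmul f (a *: g).
Proof.
rewrite !pmul.unlock [in LHS]/plin scaler_sumr; apply: eq_bigr => w _.
rewrite scalerA mulrC -scalerA; congr (_ *: _).
by rewrite -plinZ.
Qed.

Lemma pmul_basis w w' : pmul (pbasis w) (pbasis w') = pbmul w w'.
Proof. by rewrite !pmul.unlock !plin_basis. Qed.

Lemma pmul0l f : pmul 0 f = 0.
Proof. by rewrite pmul.unlock raddf0. Qed.

Lemma pmul0r f : pmul f 0 = 0.
Proof. by rewrite -[X in pmul f X](scale0r 0) -pmulZr scale0r. Qed.

Lemma pmulA : associative pmul.
Proof.
move=> f g h; elim/path_alg_ind: f => [|a x f IHf]; first by rewrite !pmul0l.
rewrite !pmulDl IHf -!pmulZl; congr (_ *: _ + _).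
elim/path_alg_ind: g {IHf} => [|b y g IHg]; first by rewrite !(pmul0l, pmul0r).
rewrite !(pmulDl, pmulDr) IHg -!pmulZr -!pmulZl -!pmulZr; congr (_ *: _ + _).
elim/path_alg_ind: h {IHg} => [|c z h IHh]; first by rewrite !pmul0r.
rewrite !pmulDr IHh -!pmulZr; congr (_ *: _ + _).
rewrite !pmul_basis /pbmul; have := pcatA x y z.
case: (pcat x y) => [u|]; case: (pcat y z) => [v|] /=.
- by rewrite !pmul_basis /pbmul => ->.
- by rewrite pmul_basis /pbmul => <-; rewrite pmul0r.
- by rewrite pmul_basis /pbmul => ->; rewrite pmul0l.
- by rewrite pmul0l pmul0r.
Qed.

Lemma pmul_suml f (r : seq (vertex Q)) (P : pred (vertex Q)) F :
  pmul (\sum_(v <- r | P v) F v) f = \sum_(v <- r | P v) pmul (F v) f.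
Proof. exact: (big_morph (pmul^~ f) (fun x y => pmulDl x y f) (pmul0l f)). Qed.

Lemma pmul_sumr f (r : seq (vertex Q)) (P : pred (vertex Q)) F :
  pmul f (\sum_(v <- r | P v) F v) = \sum_(v <- r | P v) pmul f (F v).
Proof. exact: (big_morph (pmul f) (pmulDr f) (pmul0r f)). Qed.

Lemma pmul1 : left_id pone pmul.
Proof.
move=> f; elim/path_alg_ind: f => [|a w f IHf]; first by rewrite pmul0r.
rewrite pmulDr -pmulZr IHf; congr (_ *: _ + _).
rewrite pmul_suml (bigD1 (psrc w)) //= pmul_basis /pbmul pcat_triv_l /=.
rewrite big1 ?addr0 // => v vw.
by rewrite pmul_basis /pbmul pcat_neq.
Qed.

Lemma pmulr1 : right_id pone pmul.
Proof.
move=> f; elim/path_alg_ind: f => [|a w f IHf]; first by rewrite pmul0l.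
rewrite pmulDl -pmulZl IHf; congr (_ *: _ + _).
rewrite pmul_sumr (bigD1 (ptgt w)) //= pmul_basis /pbmul pcat_triv_r /=.
rewrite big1 ?addr0 // => v vw.
by rewrite pmul_basis /pbmul pcat_neq // eq_sym.
Qed.

Lemma pone_neq0 : pone != 0.
Proof.
have /card_gt0P[v _] := vertex_gt0 Q.
apply/eqP => /(congr1 (pcoef (triv v))).
rewrite pcoef0 raddf_sum (bigD1 v) //= pcoef_basis eqxx big1 ?addr0.
  by apply/eqP; rewrite oner_eq0.
move=> u uv; rewrite pcoef_basis; case: eqP => // -[e].
by rewrite e eqxx in uv.
Qed.

HB.instance Definition _ := GRing.Zmodule_isNzRing.Build path_alg
  pmulA pmul1 pmulr1 pmulDl pmulDr pone_neq0.
HB.instance Definition _ := GRing.Lmodule_isLalgebra.Build K path_alg pmulZl.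
HB.instance Definition _ := GRing.Lalgebra_isAlgebra.Build K path_alg pmulZr.

(* Span of the paths of length at least m; this is the m-th power of the arrow
   ideal. *)
Definition paths_ge (m : nat) : path_alg -> bool :=
  fun f => all (fun w => m <= plen w)%N (psupp f).

Lemma paths_geP m (f : path_alg) :
  reflect (forall w, (plen w < m)%N -> pcoef w f = 0) (f \in paths_ge m).
Proof.
apply: (iffP allP) => [fm w|fm w].
  by rewrite ltnNge => wm; apply/eqP; rewrite pcoef_eq0; apply: contra wm => /fm.
by apply: contraLR; rewrite -ltnNge => /fm fw; rewrite -pcoef_eq0 fw.
Qed.

Lemma paths_ge_zmod m : zmod_closed (paths_ge m).
Proof.
split=> [|f g /paths_geP fm /paths_geP gm]; apply/paths_geP => w wm.
  by rewrite pcoef0.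
by rewrite raddfB /= fm ?gm ?subr0.
Qed.

HB.instance Definition _ m :=
  GRing.isZmodClosed.Build path_alg (paths_ge m) (paths_ge_zmod m).

Lemma paths_geZ m (a : K) (f : path_alg) :
  f \in paths_ge m -> a *: f \in paths_ge m.
Proof.
by move/paths_geP=> fm; apply/paths_geP => w wm; rewrite pcoefZ fm ?mulr0.
Qed.

Lemma paths_ge_basis m w : (m <= plen w)%N -> pbasis w \in paths_ge m.
Proof.
move=> wm; apply/paths_geP => u um; rewrite pcoef_basis.
by case: eqP => // uw; rewrite -uw ltnNge wm in um.
Qed.

Lemma paths_ge_mul m m' (f g : path_alg) :
  f \in paths_ge m -> g \in paths_ge m' -> f * g \in paths_ge (m + m').
Proof.
move=> /allP fm /allP gm; rewrite /GRing.mul /= pmul.unlock /plin.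
rewrite big_seq rpred_sum // => w /fm wm; apply: paths_geZ.
rewrite big_seq rpred_sum // => w' /gm wm'; apply: paths_geZ.
rewrite /pbmul; case e: (pcat w w') => [u|] /=; last exact: rpred0.
by apply: paths_ge_basis; rewrite (pcat_len e) leq_add.
Qed.

Lemma paths_ge0 (f : path_alg) : f \in paths_ge 0.
Proof. exact/allP. Qed.

Lemma paths_ge_l m (f g : path_alg) :
  g \in paths_ge m -> f * g \in paths_ge m.
Proof. exact: (@paths_ge_mul 0 m f g (paths_ge0 f)). Qed.

Lemma paths_ge_r m (f g : path_alg) :
  g \in paths_ge m -> g * f \in paths_ge m.
Proof. by move=> gm; rewrite -[m]addn0; apply: paths_ge_mul gm (paths_ge0 f). Qed.

HB.instance Definition _ m := isNuSubalg.Build K path_alg (paths_ge m)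
  (@paths_geZ m) (fun f g _ => @paths_ge_l m f g).
HB.instance Definition _ m := isTwoSided.Build K path_alg (paths_ge m)
  (@paths_ge_l m) (@paths_ge_r m).

Definition commutativity_relation (f : path_alg) : Prop :=
  exists w w' : qpath Q,
    [/\ (0 < plen w)%N, (0 < plen w')%N, psrc w = psrc w', ptgt w = ptgt w' &
        f = pbasis w - pbasis w'].

Definition admissible (J : twoSidedIdeal path_alg) : Prop :=
  exists2 m, (2 <= m)%N &
    {subset (paths_ge m : {pred path_alg}) <= J} /\ {subset J <= paths_ge 2}.

(* [admissible] with [J <= R] in place of [J <= R^2]. When a line a - b of the
   diagram skips a column (e.g. 1 - 4 for d = (2, 1, 2)), the arrow a -> b is
   parallel to a path of length at least 2, and their difference is a
   commutativity relation lying outside R^2. *)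
Definition weakly_admissible (J : twoSidedIdeal path_alg) : Prop :=
  exists2 m, (2 <= m)%N &
    {subset (paths_ge m : {pred path_alg}) <= J} /\ {subset J <= paths_ge 1}.

Definition rad : nuSubalg path_alg := NuSubalg.clone K path_alg (paths_ge 1) _.

(* rad KQ / J; only meaningful for J contained in rad KQ. *)
Definition rad_quot (J : twoSidedIdeal path_alg) : lieAlgType K :=
  lie_quot (LieIdeal.clone K _ (@lie_restr K path_alg rad J) _).

End PathAlgebra.

Section LineDiagram.
Variable d : seq nat.

(* Dots, vertices, matrix indices, columns and rows are numbered from 0. *)
Definition dot_col (a : nat) : nat := reshape_index d a.
Definition dot_row (a : nat) : nat := reshape_offset d a.

Definition hline (n : nat) (a b : 'I_n.+1) : bool :=
  [&& dot_row a == dot_row b, (dot_col a < dot_col b)%N &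
      [forall c : 'I_n.+1,
         ~~ [&& dot_row c == dot_row a, (dot_col a < dot_col c)%N &
                (dot_col c < dot_col b)%N]]].

Definition joined (n : nat) (ab : 'I_n.+1 * 'I_n.+1) : bool :=
  hline ab.1 ab.2 || (dot_col ab.2 == (dot_col ab.1).+1).

Lemma ord_gt0 n : (0 < #|'I_n.+1|)%N.
Proof. by rewrite card_ord. Qed.

Definition Qd (n : nat) : quiver := {|
  vertex := 'I_n.+1;
  arrow := {ab : 'I_n.+1 * 'I_n.+1 | joined ab};
  src := fun e => (val e).1;
  tgt := fun e => (val e).2;
  vertex_gt0 := ord_gt0 n
|}.

Section Nilradical.
Variables (K : comNzRingType) (n : nat).

(* Strictly block upper triangular matrices. For p dividing n + 1 the largest
   nilpotent ideal of the block upper triangular matrices of trace 0 also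
   contains the scalar matrices. *)
Definition nilrad : 'M[K]_n.+1 -> bool :=
  fun A => [forall i, forall j, (A i j != 0) ==> (dot_col i < dot_col j)%N].

Lemma nilradP (A : 'M[K]_n.+1) :
  reflect (forall i j : 'I_n.+1, ~~ (dot_col i < dot_col j)%N -> A i j = 0)
    (A \in nilrad).
Proof.
apply: (iffP forallP) => [Au i j|Au i].
  have /forallP/(_ j)/implyP Aij := Au i.
  by move=> nij; apply/eqP; apply: contraNT nij.
by apply/forallP => j; apply/implyP; apply: contraR => /Au ->.
Qed.

Lemma nilrad_zmod : zmod_closed nilrad.
Proof.
split=> [|A B /nilradP Au /nilradP Bu]; apply/nilradP => i j nij.
  by rewrite mxE.
by rewrite !mxE Au ?Bu ?subr0.
Qed.

HB.instance Definition _ := GRing.isZmodClosed.Build 'M[K]_n.+1 nilrad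
  nilrad_zmod.

Lemma nilradZ (a : K) (A : 'M[K]_n.+1) : A \in nilrad -> a *: A \in nilrad.
Proof.
by move/nilradP=> Au; apply/nilradP => i j nij; rewrite mxE Au ?mulr0.
Qed.

Lemma nilradM (A B : 'M[K]_n.+1) :
  A \in nilrad -> B \in nilrad -> A * B \in nilrad.
Proof.
move=> /nilradP Au /nilradP Bu; apply/nilradP => i j nij.
rewrite mxE big1 // => k _.
have [ik|ik] := boolP (dot_col i < dot_col k)%N; last by rewrite Au ?mul0r.
by rewrite Bu ?mulr0 //; apply: contra nij; apply: ltn_trans.
Qed.

HB.instance Definition _ := isNuSubalg.Build K 'M[K]_n.+1 nilrad
  nilradZ nilradM.

Definition nilrad_lie : lieAlgType K :=
  lie_of (NuSubalg.clone K 'M[K]_n.+1 nilrad _).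

End Nilradical.

End LineDiagram.

Definition no_skip (d : seq nat) (n : nat) : Prop :=
  forall a b : 'I_n.+1, hline d a b -> dot_col d b = (dot_col d a).+1.

(* Main.v *)
Require Import Defs.
From HB Require Import structures.
From mathcomp Require Import all_boot all_order all_algebra.
From mathcomp Require Import generic_quotient ring_quotient.

(** Every arrow of the quiver goes from a column to a later one, and since no
    column is empty, adjacent columns already give a path of positive length
    from [a] to [b] whenever [a] lies in a column before that of [b].  So the
    pairs (source, target) of paths of positive length are exactly the
    positions of the matrix units that span the nilradical.

    The algebra morphism [path_mx], which sends a path from [i] to [j] to the
    matrix unit e_ij, therefore maps rad KQ onto the nilradical, and the ideal
    J is its kernel.  Choosing a path [std i j] for each such position
    gives a linear section [path_sec] of [path_mx].  Modulo any ideal that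
    contains the commutativity relations an element [f] of rad KQ equals
    [path_sec (path_mx f)] ([sub_sec_mem]), which vanishes for [f] in J: so J
    is generated by these relations.  The isomorphism is [path_sec] followed
    by the projection modulo J.

    The two admissibility claims come from the column number, which grows
    along arrows ([plen_grade]).  Path lengths are bounded, so a high power of
    the arrow ideal is zero.  A path which is alone between its end points has
    its coefficient read off as a matrix entry ([path_mx_lone]); trivial paths
    are always alone, which gives J <= rad KQ, and without skipping lines so
    are the arrows, which gives J <= (rad KQ)^2. *)

Set Implicit Arguments.
Unset Strict Implicit.
Unset Printing Implicit Defensive.

Import GRing.Theory.
Local Open Scope ring_scope.
Local Open Scope quotient_scope.

(** * Paths and their lengths *)

Lemma plen_grade (Q : quiver) (h : vertex Q -> nat) :
  (forall e : arrow Q, (h (src e) < h (tgt e))%N) ->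
  forall w : qpath Q, (h (psrc w) + plen w <= h (ptgt w))%N.
Proof.
move=> h_lt [[v s] vs]; move: vs.
rewrite /ptgt /plen /psrc /parr /composable /=.
elim: s v => [|e s IHs] v /=; first by rewrite addn0.
rewrite eqseq_cons => /andP[/eqP ev /IHs le_s]; rewrite -ev.
apply: leq_trans le_s.
by rewrite addnS -addSn leq_add2r.
Qed.

Lemma plen0_triv (Q : quiver) (w : qpath Q) : plen w = 0%N -> w = triv (psrc w).
Proof.
by case: w => [[v [|e s]] vs] //= _; apply: val_inj.
Qed.

Lemma plen1_inj (Q : quiver) (w w' : qpath Q) :
  (forall e e' : arrow Q, src e = src e' -> tgt e = tgt e' -> e = e') ->
  plen w = 1%N -> plen w' = 1%N ->
  psrc w = psrc w' -> ptgt w = ptgt w' -> w = w'.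
Proof.
move=> simple; case: w => [[v [|e []]] //= vs].
case: w' => [[v' [|e' []]] //= vs'].
rewrite /ptgt /psrc /= => _ _ vv' ee'; apply: val_inj; rewrite /= vv'.
move: vs vs'; rewrite /composable /= !eqseq_cons !andbT => /eqP ev /eqP ev'.
by rewrite (simple e e') // ev ev'.
Qed.

(** * From the path algebra to matrices *)

Section PathMatrix.
Variables (K : comNzRingType) (d : seq nat) (n : nat).
Local Notation Q := (Qd d n).
Local Notation A := (path_alg K Q).
Local Notation col := (dot_col d).

Lemma arrow_col (e : arrow Q) : (col (src e) < col (tgt e))%N.
Proof.
by case: e => [[a b] /= /orP[/and3P[]|/eqP /= ->]].
Qed.

Lemma plen_col (w : qpath Q) :
  (col (psrc w : 'I_n.+1) + plen w <= col (ptgt w : 'I_n.+1))%N.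
Proof. exact: (@plen_grade Q (fun a : 'I_n.+1 => col a) arrow_col). Qed.

Definition path_mx : A -> 'M[K]_n.+1 :=
  plin (fun w : qpath Q => delta_mx (psrc w) (ptgt w) : 'M[K]_n.+1).

HB.instance Definition _ :=
  GRing.isLinear.Build K A 'M[K]_n.+1 _ path_mx (@plin_is_linear K Q _ _).

Lemma path_mx_basis (w : qpath Q) :
  path_mx (pbasis K w) = delta_mx (psrc w) (ptgt w).
Proof. exact: plin_basis. Qed.

Lemma path_mxM (f g : A) : path_mx (f * g) = path_mx f * path_mx g.
Proof.
elim/path_alg_ind: f => [|a w f IHf]; first by rewrite !(mul0r, linear0).
rewrite mulrDl !linearD /= mulrDl IHf -scalerAl !linearZ /= -scalerAl.
congr (_ *: _ + _) => {IHf f a}.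
elim/path_alg_ind: g => [|b u g IHg]; first by rewrite !(mulr0, linear0).
rewrite mulrDr !linearD /= mulrDr IHg -scalerAr !linearZ /= -scalerAr.
congr (_ *: _ + _) => {IHg g b}.
rewrite [_ * pbasis K u]pmul_basis /pbmul !path_mx_basis.
have [e|e] := eqVneq (ptgt w) (psrc u).
  have [v ev _] := pcatP e; rewrite ev /= path_mx_basis.
  by rewrite (pcat_src ev) (pcat_tgt ev) e [RHS]mul_delta_mx.
by rewrite pcat_neq //= linear0 [RHS]mul_delta_mx_0.
Qed.

Lemma path_mx_lone (w : qpath Q) (f : A) :
  (forall u : qpath Q, psrc u = psrc w -> ptgt u = ptgt w -> u = w) ->
  path_mx f (psrc w) (ptgt w) = pcoef w f.
Proof.
move=> lone; elim/path_alg_ind: f => [|a u f IHf].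
  by rewrite linear0 mxE pcoef0.
rewrite linearD linearZ /= mxE IHf pcoefD mxE pcoefZ path_mx_basis mxE.
rewrite pcoef_basis; congr (_ * (nat_of_bool _)%:R + _).
apply/andP/eqP => [[/eqP su /eqP tu]|->]; last by rewrite !eqxx.
by rewrite (lone u).
Qed.

Lemma path_mx_nilrad (f : A) : f \in paths_ge 1 -> path_mx f \in @nilrad d K n.
Proof.
move/allP=> f1; apply/nilradP => i j nij.
rewrite /path_mx /plin summxE big_seq big1 // => w /f1 w1.
rewrite !mxE; case: eqP => [si|_] /=; last by rewrite mulr0.
case: eqP => [tj|_] /=; last by rewrite mulr0.
case/negP: nij; rewrite si tj; apply: leq_trans (plen_col w).
by rewrite -addn1 leq_add2l.
Qed.

(** * The kernel and its position in the arrow ideal *)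

Definition path_ker : A -> bool := fun f => path_mx f == 0.

Lemma path_ker_zmod : zmod_closed path_ker.
Proof.
split=> [|f g]; rewrite !unfold_in /path_ker ?linear0 // => /eqP f0 /eqP g0.
by rewrite linearB /= f0 g0 subr0.
Qed.

HB.instance Definition _ := GRing.isZmodClosed.Build A path_ker path_ker_zmod.

Lemma path_kerP (f : A) : reflect (path_mx f = 0) (f \in path_ker).
Proof. exact: eqP. Qed.

Lemma path_ker_l (f g : A) : g \in path_ker -> f * g \in path_ker.
Proof. by move/path_kerP=> g0; apply/path_kerP; rewrite path_mxM g0 mulr0. Qed.

Lemma path_ker_r (f g : A) : g \in path_ker -> g * f \in path_ker.
Proof. by move/path_kerP=> g0; apply/path_kerP; rewrite path_mxM g0 mul0r. Qed.

HB.instance Definition _ := isTwoSided.Build K A path_ker path_ker_l path_ker_r.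

Definition path_ideal : twoSidedIdeal A := TwoSidedIdeal.clone K A path_ker _.

(** A trivial path is alone between its end points, because arrows change
    the column. *)
Lemma path_ker_rad : {subset path_ker <= (paths_ge 1 : {pred A})}.
Proof.
move=> f /path_kerP f0; apply/paths_geP => w; rewrite ltnS leqn0 => /eqP w0.
rewrite -path_mx_lone ?f0 ?mxE // (plen0_triv w0) => u su tu.
have u0: plen u = 0%N.
  apply/eqP; rewrite -leqn0 -(leq_add2l (col (psrc u : 'I_n.+1))) addn0.
  by rewrite (leq_trans (plen_col u)) // tu su.
by rewrite (plen0_triv u0) su.
Qed.

(** Here the column grows by exactly one along any arrow, hence every path
    parallel to an arrow is itself an arrow. *)
Lemma path_ker_rad2 :
  no_skip d n -> {subset path_ker <= (paths_ge 2 : {pred A})}.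
Proof.
move=> noskip f fJ; apply/paths_geP => w.
rewrite ltnS leq_eqVlt => /orP[/eqP w1|]; last exact/paths_geP/path_ker_rad.
have simple (e e' : arrow Q) : src e = src e' -> tgt e = tgt e' -> e = e'.
  case: e e' => [[a b] ab] [[a' b'] ab'] /= aa' bb'.
  by apply: val_inj; rewrite /= aa' bb'.
have w_col : col (ptgt w : 'I_n.+1) = (col (psrc w : 'I_n.+1)).+1.
  case: w w1 => [[v [|e []]] //= vs] _; move: vs; rewrite /ptgt /psrc /=.
  rewrite /composable /= eqseq_cons andbT => /eqP <-.
  by case: e => [[a b] /= /orP[/noskip|/eqP]].
rewrite -path_mx_lone ?(path_kerP _ fJ) ?mxE // => u su tu.
apply: plen1_inj => //.
have u_le1 : (plen u <= 1)%N.
  rewrite -(leq_add2l (col (psrc u : 'I_n.+1))) addn1.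
  by rewrite (leq_trans (plen_col u)) // tu su w_col.
apply/eqP; rewrite eqn_leq u_le1 lt0n; apply/eqP => u0.
have: col (ptgt w : 'I_n.+1) = col (psrc w : 'I_n.+1).
  by rewrite -su -tu (plen0_triv u0).
by rewrite w_col => /esym/n_Sn.
Qed.

(** * A section of the matrix map and the generators of the kernel *)

Definition joins (i j : 'I_n.+1) (w : qpath Q) : Prop :=
  [/\ psrc w = i, ptgt w = j & (0 < plen w)%N].

Definition path_choice (std : 'I_n.+1 -> 'I_n.+1 -> qpath Q) : Prop :=
  forall i j : 'I_n.+1, (col i < col j)%N -> joins i j (std i j).

Section PathSection.
Variable std : 'I_n.+1 -> 'I_n.+1 -> qpath Q.
Hypothesis stdP : path_choice std.

Definition path_sec (M : 'M[K]_n.+1) : A :=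
  \sum_i \sum_j M i j *: pbasis K (std i j).

Lemma path_sec_is_linear : linear path_sec.
Proof.
move=> a M N; rewrite /path_sec scaler_sumr -big_split; apply: eq_bigr => i _.
rewrite /= scaler_sumr -big_split; apply: eq_bigr => j _ /=.
by rewrite !mxE scalerDl scalerA.
Qed.

HB.instance Definition _ :=
  GRing.isLinear.Build K 'M[K]_n.+1 A _ path_sec path_sec_is_linear.

Lemma path_sec_delta i j : path_sec (delta_mx i j) = pbasis K (std i j).
Proof.
rewrite /path_sec (bigD1 i) //= (bigD1 j) //= mxE !eqxx scale1r.
rewrite !big1 ?addr0 // => [i' /negPf i'i|j' /negPf j'j].
  by rewrite big1 // => j' _; rewrite mxE i'i scale0r.
by rewrite mxE j'j andbF scale0r.
Qed.

Lemma path_sec_rad M : M \in @nilrad d K n -> path_sec M \in paths_ge 1.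
Proof.
move/nilradP=> Mu; rewrite rpred_sum // => i _; rewrite rpred_sum // => j _.
have [/stdP[_ _ w_gt0]|/Mu ->] := boolP (col i < col j)%N.
  exact/paths_geZ/paths_ge_basis.
by rewrite scale0r rpred0.
Qed.

Lemma path_secK M : M \in @nilrad d K n -> path_mx (path_sec M) = M.
Proof.
move/nilradP=> Mu; rewrite [RHS]matrix_sum_delta linear_sum.
apply: eq_bigr => i _; rewrite linear_sum; apply: eq_bigr => j _.
rewrite linearZ /= path_mx_basis.
by have [/stdP[-> -> _]|/Mu ->] := boolP (col i < col j)%N; rewrite ?scale0r.
Qed.

(** Both sides are linear in [f], and for a path of positive length the
    difference is a commutativity relation. *)
Lemma sub_sec_mem (I : twoSidedIdeal A) (f : A) :
  (forall g, commutativity_relation g -> g \in I) ->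
  f \in paths_ge 1 -> f - path_sec (path_mx f) \in I.
Proof.
move=> relI /allP f1.
rewrite {1}[f]path_algE /path_mx /plin (linear_sum path_sec) /= -sumrB big_seq.
rewrite rpred_sum // => w /f1 w1; rewrite linearZ /= -scalerBr -mulr_algl.
apply/two_sided_l/relI; rewrite path_sec_delta.
have /stdP[su tu u1] : (col (psrc w : 'I_n.+1) < col (ptgt w : 'I_n.+1))%N.
  by apply: leq_trans (plen_col w); rewrite -addn1 leq_add2l.
by exists w, (std (psrc w) (ptgt w)); split.
Qed.

Lemma path_ideal_generates :
  generates (@commutativity_relation K Q) path_ideal.
Proof.
split=> [f [w [w' [_ _ ss' tt' ->]]]|I relI f fJ].
  by apply/path_kerP; rewrite linearB /= !path_mx_basis ss' tt' subrr.
have := sub_sec_mem relI (path_ker_rad fJ).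
by rewrite (path_kerP _ fJ) linear0 subr0.
Qed.

End PathSection.

(** * Existence and boundedness of paths *)

Section PositivePaths.
Hypotheses (d_gt0 : all (ltn 0%N) d) (sum_d : sumn d = n.+1).

Lemma col_lt (i : 'I_n.+1) : (col i < size d)%N.
Proof. by apply: reshape_indexP; rewrite sum_d. Qed.

Lemma col_dot c : (c < size d)%N -> exists a : 'I_n.+1, col a = c.
Proof.
move=> c_lt; have dc : (0 < nth 0 d c)%N by apply: (allP d_gt0); apply: mem_nth.
have lt : (flatten_index d c 0 < n.+1)%N.
  by rewrite -sum_d flatten_indexP.
by exists (Ordinal lt); rewrite /dot_col /= flatten_indexKl.
Qed.

(** Since no column is empty, the column just before that of [j] contains a
    dot [k]; the arrow from [k] to [j] extends a path from [i] to [k]. *)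
Lemma ex_path (i j : 'I_n.+1) : (col i < col j)%N ->
  exists w, joins i j w.
Proof.
elim: (col j) {-2}j (erefl (col j)) => {j} [|c IHc] j col_j; rewrite col_j //.
have arrow_to_j (k : 'I_n.+1) : col k = c ->
    exists w, joins k j w.
  move=> col_k.
  have kj : joined d (k, j) by rewrite /joined /= col_j col_k eqxx orbT.
  have w_ok : composable (Q := Q) (k, [:: exist _ (k, j) kj]) by exact: eqxx.
  by exists (QPath w_ok).
rewrite ltnS leq_eqVlt => /orP[/eqP|i_lt]; first exact: arrow_to_j.
have [|k col_k] := @col_dot c.
  by apply: leq_trans (col_lt j); rewrite col_j.
have [|w [si tk w_gt0]] := IHc k col_k; first by rewrite col_k.
have [w' [sk tj _]] := arrow_to_j k col_k.
have [|u eu _] := @pcatP Q w w'; first by rewrite tk.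
exists u; split; first by rewrite (pcat_src eu).
  by rewrite (pcat_tgt eu).
by rewrite (pcat_len eu) ltn_addr.
Qed.

Lemma ex_path_choice : exists std, path_choice std.
Proof.
have ex_entry (i j : 'I_n.+1) : exists w, (col i < col j)%N -> joins i j w.
  have [/ex_path[w ?]|_] := boolP (col i < col j)%N; first by exists w.
  (* Any path does as the default value. *)
  by exists (triv (i : vertex Q)).
have [std stdP] := fin_all_exists (fun i => fin_all_exists (ex_entry i)).
by exists std.
Qed.

(** The length of a path is at most the column of its target. *)
Lemma paths_ge_zero (f : A) : f \in paths_ge (size d) -> f = 0.
Proof.
move=> fd; apply: pcoefP => w; rewrite pcoef0; apply: (paths_geP _ _ fd).
apply: leq_ltn_trans (col_lt (ptgt w)).
by apply: leq_trans (plen_col w); rewrite leq_addl.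
Qed.

(** The exponent is raised by 2 only because an admissibility exponent has to
    be at least 2, whereas there may be a single column. *)
Lemma paths_ge_high (J : twoSidedIdeal A) :
  {subset (paths_ge (size d).+2 : {pred A}) <= J}.
Proof.
move=> f fd; suff -> : f = 0 by exact: rpred0.
apply: paths_ge_zero; apply/paths_geP => w w_lt.
by apply: (paths_geP _ _ fd); rewrite ltnW // ltnW.
Qed.

Lemma path_ideal_weakly_admissible : weakly_admissible path_ideal.
Proof.
exists (size d).+2 => //.
by split; [exact: paths_ge_high|exact: path_ker_rad].
Qed.

Lemma path_ideal_admissible : no_skip d n -> admissible path_ideal.
Proof.
move=> noskip; exists (size d).+2 => //.
by split; [exact: paths_ge_high|exact: path_ker_rad2].
Qed.

End PositivePaths.

(** * The Lie algebra isomorphism *)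

Section Isomorphism.
Variable std : 'I_n.+1 -> 'I_n.+1 -> qpath Q.
Hypothesis stdP : path_choice std.
Local Notation N := (nilrad_lie d K n).
Local Notation R := (lie_of (Defs.rad K Q)).
Local Notation I :=
  (LieIdeal.clone K R (@lie_restr K A (Defs.rad K Q) path_ideal) _).

Lemma pi_radP (x y : R) :
  reflect (path_mx (val x) = path_mx (val y))
          (\pi_(lie_quot I) x == \pi_(lie_quot I) y).
Proof.
rewrite -Quotient.idealrBE lie_restrE raddfB /=.
apply: (iffP (path_kerP _)); rewrite linearB /=; first exact: subr0_eq.
by move=> ->; rewrite subrr.
Qed.

Definition nil_sec (x : N) : R := LieOf (path_sec_rad stdP (valP x)).

Definition nil_to_quot (x : N) : rad_quot path_ideal :=
  \pi_(lie_quot I) (nil_sec x).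

Definition quot_to_nil (q : rad_quot path_ideal) : N :=
  LieOf (path_mx_nilrad (valP (repr (q : lie_quot I)))).

Lemma nil_to_quot_is_linear : linear nil_to_quot.
Proof.
move=> a x y; rewrite /nil_to_quot -pi_lqZ -pi_lqD; congr (\pi _).
by apply: val_inj; rewrite /= linearP.
Qed.

HB.instance Definition _ := GRing.isLinear.Build K N (rad_quot path_ideal) _
  nil_to_quot nil_to_quot_is_linear.

(** Not because [path_sec] preserves products: a product of chosen paths need
    not be a chosen path, but it has the same matrix. *)
Lemma nil_to_quot_lie : {morph nil_to_quot : x y / lie x y}.
Proof.
move=> x y; rewrite /nil_to_quot -[RHS]pi_lq_lie; apply/eqP/pi_radP => /=.
have Nx := valP x; have Ny := valP y.
rewrite [in RHS]linearB /= !path_mxM !(path_secK stdP) //.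
by rewrite rpredB // nilradM.
Qed.

Lemma nil_to_quot_bij : bijective nil_to_quot.
Proof.
exists quot_to_nil => [x|q].
  apply: val_inj => /=; rewrite -[RHS](path_secK stdP (valP x)).
  by apply/(@pi_radP _ (nil_sec x)); rewrite reprK.
rewrite -[RHS](reprK (q : lie_quot I)); apply/eqP/pi_radP => /=.
by rewrite (path_secK stdP) // path_mx_nilrad // (valP (repr (q : lie_quot I))).
Qed.

Lemma nilrad_rad_quot : lie_isomorphic N (rad_quot path_ideal).
Proof.
by exists nil_to_quot; [exact: nil_to_quot_bij|exact: nil_to_quot_lie].
Qed.

End Isomorphism.

End PathMatrix.

Theorem theorem2p1 (p : nat) (K : closedFieldType) (pcharK : p \in [pchar K])
    (n : nat) (d : seq nat) (d_gt0 : all (ltn 0%N) d)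
    (sum_d : sumn d = n.+1) :
  exists J : twoSidedIdeal (path_alg K (Qd d n)),
    [/\ generates (@commutativity_relation K (Qd d n)) J,
        weakly_admissible J,
        (no_skip d n -> admissible J) &
        lie_isomorphic (nilrad_lie d K n) (rad_quot J)].
Proof.
have [std stdP] := ex_path_choice d_gt0 sum_d.
exists (path_ideal K d n); split.
- exact: path_ideal_generates stdP.
- exact: path_ideal_weakly_admissible.
- exact: path_ideal_admissible.
- exact: nilrad_rad_quot stdP.
Qed.
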